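(* Let $X$ be an infinite Tychonoff space. The function space $C_p(X)$ has the Josefson--Nissenzweig property (JNP) if and only if there is a sequence $\{\mu_n\}_{n\in\omega}\subseteq C_p(X)'$ converging to $0$ in the weak$^*$ topology $\sigma(C_p(X)',C_p(X))$ that consists of finitely supported sign-measures on $X$ of norm $1$ (that is, $\|\mu_n\|=1$ for every $n\in\omega$).
   Context: All locally convex spaces (lcs) are over the field $\mathbb{F}$ of real or complex numbers, Hausdorff and infinite-dimensional. $E'$ is the topological dual of $E$. A barrel in an lcs $E$ is a closed absorbent absolutely convex subset. A set $B\subseteq E$ is barrel-bounded if for every barrel $U\subseteq E$ there is $n\in\mathbb{N}$ with $B\subseteq nU$. The topology $\beta^*(E',E)$ on $E'$ is the locally convex topology of uniform convergence on barrel-bounded subsets of $E$: a neighborhood base at zero is given by the polars $B^\circ=\{\chi\in E': |\chi(x)|\le 1 \text{ for all } x\in B\}$ of barrel-bounded sets $B\subseteq E$. $E'_{w^*}$ is $E'$ with the weak$^*$ topology $\sigma(E',E)$ and $E'_{\beta^*}$ is $E'$ with $\beta^*(E',E)$. The space $E$ has the Josefson--Nissenzweig property (JNP) if the identity map $E'_{w^*}\to E'_{\beta^*}$ is not sequentially continuous; equivalently, there is a sequence in $E'$ converging to $0$ in $\sigma(E',E)$ but not in $\beta^*(E',E)$. $C_p(X)$ is the space of all continuous functions $X\to\mathbb{F}$ with the topology of pointwise convergence. Elements of $C_p(X)'$ are identified with finitely supported ($\mathbb{F}$-valued) sign-measures $\mu=\sum_{i=1}^k a_i\delta_{x_i}$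 on $X$ ($x_i\in X$ distinct, $a_i\in\mathbb{F}$, $\delta_x$ the Dirac measure at $x$), acting by $\mu(f)=\sum_i a_if(x_i)$; the norm is $\|\mu\|=|\mu|(X)=\sum_i|a_i|=\sup\{|\mu(f)|: f\in C(X),\ \sup_{x\in X}|f(x)|\le 1\}$. *)

(* Defs.v *)
From HB Require Import structures.
From mathcomp Require Import all_boot all_order all_algebra finmap complex.
From mathcomp Require Import all_classical all_reals all_analysis.

Set Implicit Arguments.
Unset Strict Implicit.
Unset Printing Implicit Defensive.

Import Order.TTheory GRing.Theory Num.Theory.
Import numFieldNormedType.Exports.

Local Open Scope classical_set_scope.
Local Open Scope ring_scope.

Variant scalars := RealScalars | ComplexScalars.

Definition scalar_field (R : realType) (k : scalars) : numFieldType :=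
  match k with
  | RealScalars => R
  | ComplexScalars => complex R
  end.

Definition tychonoff_space (X : topologicalType) :=
  completely_regular_space X /\ hausdorff_space X.

Definition sequentially_continuous (T U : topologicalType) (f : T -> U) :=
  forall (u : nat -> T) (l : T), u @ \oo --> l -> f \o u @ \oo --> f l.

Section barrels.
Context {K : numFieldType} {E : tvsType K}.
Implicit Types U B : set E.

Definition absolutely_convex U :=
  forall (x y : E) (a b : K), U x -> U y -> `|a| + `|b| <= 1 ->
    U (a *: x + b *: y).

Definition absorbent U :=
  forall x : E, exists2 r : K, 0 < r &
    forall a : K, r <= `|a| -> [set a *: u | u in U] x.

Definition barrel U := [/\ closed U, absorbent U & absolutely_convex U].

Definition barrel_bounded B :=
  forall U, barrel U -> exists n : nat, B `<=` [set n%:R *: u | u in U].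

End barrels.

Lemma initial_cvg (S : choiceType) (T : topologicalType) (f : S -> T)
    (F : set_system S) (s : S) : Filter F ->
  F --> (s : initial_topology f) <-> f @ F --> f s.
Proof.
move=> FF; split=> [Fs|fFs A [_ [[B oB <-] Bfs] BA]].
  apply: cvg_trans (@initial_continuous _ _ f s).
  exact: cvg_app Fs.
by apply: (filterS BA); apply: fFs; exact: open_nbhs_nbhs.
Qed.

Section dual.
Context {K : numFieldType} (E : tvsType K).

Definition continuous_functional : {pred E -> K} :=
  mem [set f : E -> K | scalar f /\ continuous f].

Record dual := Dual {
  dual_val :> E -> K;
  dual_valP : dual_val \in continuous_functional }.

HB.instance Definition _ := [isSub for dual_val].
HB.instance Definition _ := [Choice of dual by <:].

Lemma continuous_functional_submod : submod_closed continuous_functional.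
Proof.
split=> [|a f g]; rewrite !inE /=.
  by split=> [b x y|]; [rewrite mulr0 addr0|exact: cst_continuous].
move=> [fl fc] [gl gc]; split=> [b x y|x].
  rewrite !fctE fl gl !scalerDr mulrDr addrACA; congr (_ + _ + _).
  by rewrite /GRing.scale/= mulrCA.
apply: cvgD (gc x); apply: cvgZr; exact: fc.
Qed.

HB.instance Definition _ :=
  GRing.isSubmodClosed.Build K (E -> K) continuous_functional
    continuous_functional_submod.
HB.instance Definition _ := [SubChoice_isSubLmodule of dual by <:].

Definition weak_star : Type := dual.
HB.instance Definition _ := GRing.Lmodule.on weak_star.
HB.instance Definition _ := Topological.copy weak_star
  (initial_topology (dual_val : dual -> {ptws E -> K})).

Definition beta_star : Type := dual.
HB.instance Definition _ := GRing.Lmodule.on beta_star.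
HB.instance Definition _ := Topological.copy beta_star
  (initial_topology (dual_val : dual -> {family barrel_bounded, E -> K})).

Definition JNP :=
  ~ sequentially_continuous (fun chi : weak_star => chi : beta_star).

Definition polar (B : set E) : set beta_star :=
  [set chi : beta_star | forall x, B x -> `|(chi : dual) x| <= 1].

End dual.

Section polars.
Context {K : numFieldType} {E : tvsType K}.
Implicit Types U B : set E.

Lemma barrel_scale U (c : K) : c != 0 -> barrel U ->
  barrel [set x | U (c *: x)].
Proof.
move=> c0 [clU abU cvU]; split.
- apply: (@preimage_closed _ _ (fun x : E => c *: x)) => // x _.
  apply: (@continuous_comp _ _ _ (fun x : E => (c : K^o, x))
    (fun z : K^o * E => z.1 *: z.2)); last exact: scale_continuous.
  by apply: (@cvg_pair _ _ _ _ (nbhs (c : K^o))); [exact: cvg_cst|exact: cvg_id].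
- move=> x; have [r r0 ar] := abU (c *: x).
  exists r => // a /ar[u Uu uE]; exists (c^-1 *: u).
    by rewrite /= scalerA divff// scale1r.
  by rewrite scalerA mulrC -scalerA uE scalerA mulVf// scale1r.
- move=> x y a b /= Ux Uy ab; rewrite scalerDr !scalerA ![c * _]mulrC -!scalerA.
  exact: cvU.
Qed.

Lemma barrel_le U (m n : nat) : barrel U -> (m <= n)%N ->
  [set m%:R *: u | u in U] `<=` [set n%:R *: u | u in U].
Proof.
move=> [_ _ cvU] mn _ [u Uu <-].
have [n0|n0] := eqVneq n 0%N.
  by move: mn; rewrite n0 leqn0 => /eqP->; exists u.
exists ((m%:R / n%:R) *: u).
  rewrite -[X in U X]addr0 -(scale0r u); apply: cvU => //.
  rewrite normr0 addr0 ger0_norm ?divr_ge0// ler_pdivrMr ?ltr0n ?lt0n//.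
  by rewrite mul1r ler_nat.
by rewrite scalerA mulrCA divff ?mulr1// pnatr_eq0.
Qed.

Lemma barrel_boundedU B C : barrel_bounded B -> barrel_bounded C ->
  barrel_bounded (B `|` C).
Proof.
move=> bB bC U bU; have [m Bm] := bB _ bU; have [n Cn] := bC _ bU.
exists (maxn m n) => x [/Bm|/Cn]; apply: barrel_le => //.
  exact: leq_maxl.
exact: leq_maxr.
Qed.

Lemma barrel_boundedZ B (c : K) : c != 0 -> barrel_bounded B ->
  barrel_bounded [set c *: x | x in B].
Proof.
move=> c0 bB U /(barrel_scale c0)/bB[n Bn]; exists n => _ [x /Bn[u Uu <-] <-].
by exists (c *: u) => //; rewrite !scalerA mulrC.
Qed.

(* beta*(E', E) has the polars of barrel-bounded sets as a base at zero. *)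
Lemma beta_star_nbhs0 (A : set (beta_star E)) :
  nbhs (0 : beta_star E) A <-> exists2 B, barrel_bounded B & polar B `<=` A.
Proof.
split=> [|[B bB BA]].
  have FF : Filter (filter_from (@barrel_bounded K E) (@polar K E)).
    apply: filter_from_filter.
      by exists set0 => U _; exists 0%N.
    move=> B C bB bC; exists (B `|` C); first exact: barrel_boundedU.
    by move=> chi Pchi; split=> x ?; apply: Pchi; [left|right].
  suff : filter_from (@barrel_bounded K E) (@polar K E) --> (0 : beta_star E).
    by apply.
  apply/initial_cvg/fam_cvgP => B bB W /uniform_nbhs[V [entV VW]].
  have [e /= e0 eV] : entourage_ ball V by rewrite entourage_ballE.
  have d0 : 2 / e != 0 by rewrite mulf_neq0 ?invr_eq0 ?gt_eqF.
  exists [set (2 / e) *: x | x in B]; first exact: barrel_boundedZ.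
  move=> chi Pchi; apply: VW => x Bx; apply: eV.
  have := Pchi _ (ex_intro2 _ _ x Bx erefl).
  have [chil _] := set_mem (dual_valP chi).
  rewrite -ball_normE /= sub0r normrN -[_ *: x]addr0 chil.
  have -> : (chi : dual E) 0 = 0.
    by have := chil (-1) 0 0; rewrite scaler0 addr0 mulN1r addNr.
  rewrite addr0 normrM (ger0_norm (divr_ge0 (ler0n K 2) (ltW e0))) => chi1.
  rewrite -(ltr_pM2l (_ : 0 < 2 / e)) ?divr_gt0//.
  rewrite divfK ?gt_eqF//; apply: le_lt_trans chi1 _.
  by rewrite ltr1n.
have : nbhs (0 : {family barrel_bounded, E -> K})
    [set g | forall x, B x -> ball ((0 : E -> K) x) 1 (g x)].
  apply: (@fam_nbhs _ _ _ _ [set xy : K * K | ball xy.1 1 xy.2]) => //.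
  by rewrite -entourage_ballE; exists 1 => /=.
move=> nb; have {nb} := @initial_continuous (dual E) _
  (@dual_val K E : dual E -> {family barrel_bounded, E -> K}) 0 _ nb.
apply: (@filterS _ (nbhs (0 : beta_star E))) => chi chi1; apply: BA => x /chi1.
by rewrite -ball_normE /= sub0r normrN => /ltW.
Qed.

End polars.

Section Cp.
Context (X : topologicalType) (K : numFieldType).

Definition continuous_function : {pred X -> K} :=
  mem [set f : X -> K | continuous f].

Record Cp := MkCp {
  Cp_val :> X -> K;
  Cp_valP : Cp_val \in continuous_function }.

HB.instance Definition _ := [isSub for Cp_val].
HB.instance Definition _ := [Choice of Cp by <:].

Lemma continuous_function_submod : submod_closed continuous_function.
Proof.
split=> [|a f g]; rewrite !inE /=; first exact: cst_continuous.
by move=> fc gc x; apply: cvgD (gc x); apply: cvgZr; exact: fc.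
Qed.

HB.instance Definition _ :=
  GRing.isSubmodClosed.Build K (X -> K) continuous_function
    continuous_function_submod.
HB.instance Definition _ := [SubChoice_isSubLmodule of Cp by <:].

HB.instance Definition _ := Uniform.copy Cp
  (initial_topology (Cp_val : Cp -> {ptws X -> K})).

Lemma Cp_cvgP (F : set_system Cp) (f : Cp) : Filter F ->
  F --> f <-> forall t, g t @[g --> F] --> f t.
Proof.
move=> FF; apply: (iff_trans (initial_cvg _ _ _)).
exact: pointwise_cvgP.
Qed.

Lemma Cp_eval_continuous (t : X) : continuous (fun f : Cp => f t).
Proof. by move=> f; have /Cp_cvgP := @cvg_id _ (nbhs f); exact. Qed.

Lemma Cp_add_continuous : continuous (fun x : Cp * Cp => x.1 + x.2).
Proof.
move=> -[f g]; apply/Cp_cvgP => t /=.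
apply: (@cvgD _ _ _ (nbhs (f, g)) _ (fun x : Cp * Cp => x.1 t)
  (fun x => x.2 t)).
- by apply: (@cvg_comp _ _ _ fst (fun h : Cp => h t) _ (nbhs f));
    [exact: cvg_fst|exact: Cp_eval_continuous].
- by apply: (@cvg_comp _ _ _ snd (fun h : Cp => h t) _ (nbhs g));
    [exact: cvg_snd|exact: Cp_eval_continuous].
Qed.

Lemma Cp_scale_continuous : continuous (fun z : K^o * Cp => z.1 *: z.2).
Proof.
move=> -[a f]; apply/Cp_cvgP => t /=.
apply: (@cvgM _ _ (nbhs (a, f)) _ (fun x : K^o * Cp => x.1)
  (fun x => x.2 t)).
- exact: cvg_fst.
- by apply: (@cvg_comp _ _ _ snd (fun h : Cp => h t) _ (nbhs f));
    [exact: cvg_snd|exact: Cp_eval_continuous].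
Qed.

Lemma Cp_locally_convex : exists2 B : set_system Cp,
  (forall b, b \in B -> convex_set b) & basis B.
Proof.
exists [set U : set Cp | open U /\ convex_set U].
  by move=> b; rewrite inE => -[].
split=> [U []//|f].
have FF : Filter (filter_from
    [set U : set Cp | (open U /\ convex_set U) /\ U f] id).
  apply: filter_from_filter.
    by exists setT; split=> //; split; [exact: openT|move=> *; rewrite inE].
  move=> U V [[oU cU] Uf] [[oV cV] Vf]; exists (U `&` V) => //.
  split=> //; split; first exact: openI.
  move=> x y l; rewrite !inE => -[Ux Vx] [Uy Vy]; split; apply/set_mem.
    by apply: cU; exact/mem_set.
  by apply: cV; exact/mem_set.
apply/Cp_cvgP => t; apply/cvg_ballP => e e0.
exists [set g : Cp | ball (f t) e (g t)]; last by [].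
split; last exact: ballxx.
split.
  have /continuousP := @Cp_eval_continuous t; apply.
  exact: ball_open.
apply/convex_setW => x y; rewrite !inE -!ball_normE /= => fx fy l l0 l1.
rewrite inE /=.
rewrite [X in `|X|](_ : _ =
    l%:num * (f t - x t) + (1 - l%:num) * (f t - y t)); last first.
  by rewrite !mulrBr addrACA -opprD -mulrDl addrC subrKC mul1r [in RHS]addrC.
rewrite (le_lt_trans (ler_normD _ _))// !normrM.
rewrite (@ger0_norm _ l%:num)// (@ger0_norm _ (1 - l%:num)) ?subr_ge0//.
rewrite -[ltRHS]mul1r -[X in X * e](subrKC l%:num) [ltRHS]mulrDl.
by rewrite ltrD// ltr_pM2l// subr_gt0.
Qed.

HB.instance Definition _ :=
  PreTopologicalNmodule_isTopologicalNmodule.Build Cp Cp_add_continuous.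
HB.instance Definition _ :=
  TopologicalNmodule_isTopologicalLmodule.Build K Cp Cp_scale_continuous.
HB.instance Definition _ := Uniform_isTvs.Build K Cp Cp_locally_convex.

End Cp.

Section fsmeasure.
Context {X : topologicalType} {K : numFieldType}.

(* mu stands for the sign-measure \sum_(x <- finsupp mu) mu x * delta_x. *)
Definition fsmeasure := {fsfun X -> K with 0}.
Implicit Types mu : fsmeasure.

Definition fsm_norm mu : K := \sum_(x <- finsupp mu) `|mu x|.

Definition fsm_int mu (f : Cp X K) : K := \sum_(x <- finsupp mu) mu x * f x.

Lemma fsm_intP mu : fsm_int mu \in @continuous_functional _ (Cp X K).
Proof.
rewrite inE; split=> [a f g|].
  rewrite /fsm_int mulr_sumr -big_split/=; apply: eq_bigr => x _.
  by rewrite mulrDr mulrCA.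
rewrite /fsm_int; elim: (enum_fset (finsupp mu)) => [|x s IHs] f.
  by under eq_fun do rewrite big_nil; exact: cst_continuous.
under eq_fun do rewrite big_cons.
by apply: cvgD (IHs f); apply: cvgM; [exact: cvg_cst|exact: Cp_eval_continuous].
Qed.

Definition fsm_dual mu : dual (Cp X K) := Dual (fsm_intP mu).

End fsmeasure.

Arguments fsmeasure : clear implicits.

(* Main.v *)
Require Import Defs.
From mathcomp Require Import all_boot all_order all_algebra finmap complex.
From mathcomp Require Import all_classical all_reals all_analysis.
From mathcomp Require Import ring.

Set Implicit Arguments.
Unset Strict Implicit.
Unset Printing Implicit Defensive.

Import Order.TTheory GRing.Theory Num.Theory.
Import numFieldNormedType.Exports.

Local Open Scope classical_set_scope.
Local Open Scope ring_scope.

(** Suppose that no weak* null sequence of measures has norm one.  Dividing by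
the norms, every weak* null sequence nu_n has norms tending to 0; this applies
to the measures g nu_n as well, for every continuous g, since
(g nu_n)(h) = nu_n(g h).  With g = f^2 one gets |nu_n|(|f|^2) -> 0 for every f,
so the set of all f such that |nu_n|(|f|^2) <= 1 for all n is a barrel.  If f is
in m times this barrel, then the inequality t <= d t^2 + 1/d gives
|nu_n(f)| <= m (d + ||nu_n|| / d), uniformly on any barrel-bounded set.

Conversely, the set of continuous functions bounded by 1 is barrel-bounded, by
the Baire argument on nested uniform balls, and a measure of norm 1 takes the
value 1 at one of its members. *)

(** * Scalars and separation, for the real and complex cases together *)

Definition archimedean_scalars (K : numFieldType) :=
  forall e : K, 0 < e -> exists n : nat, e < n%:R.

Definition cauchy_complete (K : numFieldType) := forall u : nat -> K,
  (forall e : K, 0 < e -> exists N, forall m n, (N <= m)%N -> (N <= n)%N ->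
    `|u m - u n| < e) ->
  exists l, forall e : K, 0 < e ->
    exists N, forall n, (N <= n)%N -> `|l - u n| < e.

(** With the two predicates above, this is the interface through which the argument sees the scalars
    and [X]. For complex scalars the bounds on [g x] also force it to be real. *)
Definition separates_finite_sets (X : topologicalType) (K : numFieldType) :=
  forall (A : {fset X}) (y : X), y \notin A -> exists g : Cp X K,
    [/\ g y = 1, forall x, x \in A -> g x = 0 & forall x, 0 <= g x <= 1].

Lemma real_cauchy_complete (R : realType) : cauchy_complete R.
Proof.
move=> u uC; have /cvg_ex[l ul] : cvgn u.
  apply/cauchy_cvgP/cauchy_exP => e e0; have [N uN] := uC _ e0.
  exists (u N); exists N => // n /= Nn; rewrite -ball_normE /=.
  by apply: uN => //.
exists l => e e0; move/cvgrPdist_lt: ul => /(_ _ e0)[N _ uN].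
by exists N => n /uN.
Qed.

Lemma norm_complex_le (R : realType) (z : complex R) :
  `|z| <= ((`|complex.Re z| + `|complex.Im z|)%:C)%C.
Proof.
rewrite normc_def lecR -[leRHS]ger0_norm ?addr_ge0// -sqrtr_sqr ler_wsqrtr//.
by rewrite sqrrD !real_normK ?num_real// lerD2r lerDl mulrn_wge0 ?mulr_ge0.
Qed.

Lemma normc_ge_Im (R : realType) (z : complex R) :
  (`|complex.Im z|%:C)%C <= `|z|.
Proof. by rewrite normc_def lecR -sqrtr_sqr ler_wsqrtr// lerDr sqr_ge0. Qed.

Lemma scalar_cauchy_complete (R : realType) (k : scalars) :
  cauchy_complete (scalar_field R k).
Proof.
case: k => /=; first exact: real_cauchy_complete.
move=> u uC.
(* Real and imaginary parts are handled alike: both respect differences and do not increase the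
   modulus, so they preserve Cauchy sequences. *)
have reC (p : complex R -> R) : (forall z, `|p z|%:C%C <= `|z|) ->
    {morph p : x y / x - y} -> exists l, forall e : R, 0 < e ->
    exists N, forall n, (N <= n)%N -> `|l - p (u n)| < e.
  move=> pz pB; apply: real_cauchy_complete => e e0.
  have [|N uN] := uC e%:C%C; first by rewrite ltcR.
  exists N => m n Nm Nn; rewrite -ltcR -pB.
  exact: le_lt_trans (pz _) (uN _ _ Nm Nn).
have [a ua] := reC (@complex.Re R) (@normc_ge_Re R) (raddfB _).
have [b ub] := reC (@complex.Im R) (@normc_ge_Im R) (raddfB _).
exists (a +i* b)%C => e e0.
(* In the order on complex numbers a positive element is real. *)
have /complex_realP[d de] := gtr0_real e0; subst e.
have d0 : 0 < d / 2 by rewrite divr_gt0// -ltcR.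
have [[M uM] [N uN]] := (ua _ d0, ub _ d0).
exists (maxn M N) => n; rewrite geq_max => /andP[/uM nM /uN nN].
apply: le_lt_trans (norm_complex_le _) _.
rewrite ltcR [ltRHS]splitr; apply: ltrD.
  by rewrite raddfB.
by rewrite raddfB.
Qed.

Lemma scalar_archimedean (R : realType) (k : scalars) :
  archimedean_scalars (scalar_field R k).
Proof.
case: k => /= e e0.
  by exists (Num.truncn e).+1; rewrite truncnS_gt.
have /complex_realP[d de] := gtr0_real e0; subst e.
exists (Num.truncn d).+1.
have -> : (Num.truncn d).+1%:R = ((Num.truncn d).+1%:R : R)%:C%C.
  by rewrite rmorph_nat.
by rewrite ltcR truncnS_gt.
Qed.

(** Carries the real-valued functions given by complete regularity over to the scalars, keeping
    their bounds. *)
Lemma scalar_embedding (R : realType) (k : scalars) :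
  exists i : R -> scalar_field R k,
    [/\ continuous i, i 0 = 0, i 1 = 1 & {homo i : x y / x <= y}].
Proof.
case: k => /=; first by exists id; split=> // x; exact: cvg_id.
exists (fun x => x%:C%C); split => //; last by move=> x y; rewrite lecR.
move=> x; apply/cvgrPdist_lt => e e0.
have /complex_realP[d de] := gtr0_real e0; subst e.
move: e0; rewrite ltcR => d0.
have := @cvg_id _ (nbhs x) => /cvgrPdist_lt/(_ _ d0).
apply: filterS => y xy; rewrite -rmorphB/= normc_def/= expr0n/= addr0 sqrtr_sqr ltcR//.
Qed.

Lemma tychonoff_separates_finite_sets (R : realType) (k : scalars)
    (X : topologicalType) :
  tychonoff_space X -> separates_finite_sets X (scalar_field R k).
Proof.
move=> [crX hX] A y yA.
have clA : closed [set` A].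
  apply: accessible_finite_set_closed.1; first exact: hausdorff_accessible.
  exact: finite_fset.
have [|f [fc f01 fy fA]] := (@uniform_separatorP _ R _ _).1 (crX y _ clA _).
  by apply/negP.
have [i [ic i0 i1 ile]] := scalar_embedding R k.
(* The separating function [f] is 0 at [y] and 1 on [A], the opposite of what is wanted. *)
have gc : (fun x => i (1 - f x)) \in @continuous_function X (scalar_field R k).
  rewrite inE => x; apply: (@continuous_comp _ _ _ (fun x => 1 - f x) i); last exact: ic.
  by apply: cvgB; [exact: cvg_cst|exact: fc].
exists (MkCp gc); split=> /=.
- by have -> : f y = 0; [apply: fy; exists y|rewrite subr0].
- by move=> x xA; have -> : f x = 1; [apply: fA; exists x|rewrite subrr].
- move=> x; have := f01 (f x); rewrite /= in_itv/= => /(_ _)/andP[|f0 f1].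
    by exists x.
  by apply/andP; split; [rewrite -i0|rewrite -i1]; rewrite ile// ?subr_ge0 ?gerBl.
Qed.

(** * Pointwise operations and interpolation *)

Section Cp_pointwise.
Context (X : topologicalType) (K : numFieldType).
Implicit Types f g : Cp X K.

Lemma Cp_ext f g : (forall x, f x = g x) -> f = g.
Proof. by move=> fg; apply/val_inj/funext. Qed.

Lemma CpZ a f x : (a *: f) x = a * f x. Proof. by []. Qed.

Lemma CpD f g x : (f + g) x = f x + g x. Proof. by []. Qed.

Lemma CpN f x : (- f) x = - f x. Proof. by []. Qed.

Lemma Cp0 x : (0 : Cp X K) x = 0. Proof. by []. Qed.

Lemma Cp_sum (s : seq X) (F : X -> Cp X K) x :
  (\sum_(y <- s) F y) x = \sum_(y <- s) F y x.
Proof. by elim: s => [|y s IHs]; rewrite ?(big_nil, big_cons) ?CpD ?IHs. Qed.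

End Cp_pointwise.

(** By induction on [A]: a new point [y] is handled by a convex combination of [f] and the constant
    [u y], weighted by a function [g] that is 1 at [y] and 0 on [A]; convexity keeps the values in
    the unit disc. *)
Lemma Cp_interpolation (X : topologicalType) (K : numFieldType)
    (sepX : separates_finite_sets X K)
    (A : seq X) (u : X -> K) :
  (forall x, `|u x| <= 1) -> exists f : Cp X K,
    (forall x, `|f x| <= 1) /\ forall x, x \in A -> f x = u x.
Proof.
move=> u1; elim: A => [|y A [f [f1 fA]]].
  by exists 0; split=> x; rewrite ?inE//= normr0.
have [yA|yA] := boolP (y \in A).
  by exists f; split=> // x; rewrite inE => /predU1P[->|]; exact: fA.
have [|g [gy gA g01]] := sepX [fset x in A]%fset y; first by rewrite inE.
have hc : (fun x => (1 - g x) * f x + g x * u y) \in @continuous_function X K.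
  have fc : continuous f := set_mem (Cp_valP f).
  have gc : continuous g := set_mem (Cp_valP g).
  rewrite inE => x; apply: cvgD; apply: cvgM.
  - by apply: cvgB; [exact: cvg_cst|exact: gc].
  - exact: fc.
  - exact: gc.
  - exact: cvg_cst.
exists (MkCp hc); split=> [x|x /[!inE]/predU1P[->|xA]] /=.
- have /andP[g0 g1] := g01 x.
  rewrite (le_trans (ler_normD _ _))// !normrM (ger0_norm g0) ger0_norm ?subr_ge0//.
  rewrite -[leRHS](subrK (g x)) lerD// ler_piMr// subr_ge0//.
- by rewrite gy subrr mul0r add0r mul1r.
- by rewrite gA ?inE// subr0 mul1r mul0r addr0 fA.
Qed.

(** * Measures with a density *)

Section fsmeasure_sums.
Context (X : topologicalType) (K : numFieldType).
Implicit Types nu : fsmeasure X K.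

Definition fsm_density nu (g : X -> K) : fsmeasure X K :=
  [fsfun x in finsupp nu => nu x * g x].

(** The support may be smaller than [A], since [h] may vanish there; the missing points contribute
    [G x 0 = 0]. *)
Lemma fsm_sumE (A : {fset X}) (h : X -> K) (G : X -> K -> K) :
  (forall x, G x 0 = 0) ->
  let mu : fsmeasure X K := [fsfun x in A => h x] in
  \sum_(x <- finsupp mu) G x (mu x) = \sum_(x <- A) G x (h x).
Proof.
move=> G0 mu.
transitivity (\sum_(x <- A) G x (mu x)).
  apply: big_fset_incl => [|x xA xmu]; first exact: finsupp_sub.
  by rewrite (fsfun_dflt xmu).
by apply: eq_big_seq => x xA; rewrite /mu fsfunE xA.
Qed.

Lemma fsm_norm_density nu g :
  fsm_norm (fsm_density nu g) = \sum_(x <- finsupp nu) `|nu x| * `|g x|.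
Proof.
rewrite /fsm_norm (fsm_sumE _ _ (G := fun _ a => `|a|)) => [|x]; last exact: normr0.
by apply: eq_bigr => x _; rewrite normrM.
Qed.

Lemma fsm_int_density nu g (f : Cp X K) :
  fsm_int (fsm_density nu g) f = \sum_(x <- finsupp nu) nu x * (g x * f x).
Proof.
rewrite /fsm_int (fsm_sumE _ _ (G := fun x a => a * f x)) => [|x]; last exact: mul0r.
by apply: eq_bigr => x _; rewrite mulrA.
Qed.

Lemma fsm_norm_ge0 nu : 0 <= fsm_norm nu.
Proof. exact: sumr_ge0. Qed.

End fsmeasure_sums.

(** * The dual of [Cp X K] and convergence in its two topologies *)

Section dual_facts.
Context (K : numFieldType) (E : tvsType K).

Lemma dualD (chi : dual E) x y : chi (x + y) = chi x + chi y.
Proof.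
have [chil _] := set_mem (dual_valP chi).
by have := chil 1 x y; rewrite !scale1r mul1r.
Qed.

Lemma dual0 (chi : dual E) : chi 0 = 0.
Proof. by apply: (addrI (chi 0)); rewrite -dualD !addr0. Qed.

Lemma dualZ (chi : dual E) a x : chi (a *: x) = a * chi x.
Proof.
have [chil _] := set_mem (dual_valP chi).
by have := chil a x 0; rewrite dual0 !addr0.
Qed.

Lemma weak_star_cvgP (u : nat -> dual E) (l : dual E) :
  ((u : nat -> weak_star E) @ \oo --> (l : weak_star E)) <->
  forall x, u n x @[n --> \oo] --> l x.
Proof.
apply: (iff_trans (initial_cvg _ _ _)).
exact: pointwise_cvgP.
Qed.

Lemma beta_star_cvgP (u : nat -> dual E) (l : dual E) :
  ((u : nat -> beta_star E) @ \oo --> (l : beta_star E)) <->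
  forall B, barrel_bounded B -> forall e : K, 0 < e ->
    \forall n \near \oo, forall x, B x -> `|l x - u n x| < e.
Proof.
apply: (iff_trans (initial_cvg _ _ _)).
apply: (iff_trans (fam_cvgP _ _ _)).
split=> [ul B bB e e0|ul B bB W /uniform_nbhs[V [entV VW]]].
  apply: (ul B bB [set g | forall x, B x -> ball (l x) e (g x)]).
  apply/uniform_nbhs; exists [set xy : K * K | ball xy.1 e xy.2]; split=> //.
  by rewrite -entourage_ballE; exists e.
have [e /= e0 eV] : entourage_ ball V by rewrite entourage_ballE.
apply: (filterS _ (ul B bB e e0)) => n un; apply: VW => x Bx; apply: eV.
exact: un.
Qed.

End dual_facts.

(** Finite sets and radii define a base of a filter [F] that converges pointwise to [h], hence in
    [Cp X K]; so every neighborhood of [h] belongs to [F]. *)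
Lemma Cp_nbhs_fset (X : topologicalType) (K : numFieldType) (h : Cp X K)
    (W : set (Cp X K)) :
  nbhs h W -> exists (A : {fset X}) (e : K), 0 < e /\
    forall f : Cp X K, (forall x, x \in A -> `|h x - f x| < e) -> W f.
Proof.
pose F := filter_from [set Ae : {fset X} * K | 0 < Ae.2]
  (fun Ae => [set f : Cp X K | forall x, x \in Ae.1 -> `|h x - f x| < Ae.2]).
have FF : Filter F.
  apply: filter_from_filter; first by exists (fset0, 1) => /=.
  move=> [A e] [B d] /= e0 d0.
  have ed := real_comparable (gtr0_real e0) (gtr0_real d0).
  exists ((A `|` B)%fset, Num.min e d) => /=.
    by rewrite (comparable_lt_min _ ed) e0.
  move=> f /= fAB; split=> x xA; have := fAB x;
    by rewrite (comparable_lt_min _ ed) inE xA ?orbT => /(_ isT)/andP[].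
suff : F --> h by move=> Fh /Fh[[A e] e0 AeW]; exists A, e; split=> // f /AeW.
apply/Cp_cvgP => t; apply/cvgrPdist_lt => e e0.
by exists ([fset t]%fset, e) => //= f /(_ t); rewrite inE eqxx => /(_ isT).
Qed.

(** Continuity bounds [chi] on a basic neighborhood given by a finite set [A], so [chi f] depends
    only on the values of [f] on [A]; the masses are the values of [chi] at functions [d x] dual to
    the points of [A]. *)
Lemma dual_Cp_fsmeasure (X : topologicalType) (K : numFieldType)
    (sepX : separates_finite_sets X K)
    (chi : dual (Cp X K)) :
  exists mu, forall f, chi f = fsm_int mu f.
Proof.
have : nbhs (0 : Cp X K) [set f | `|chi f| < 1].
  have [_ chic] := set_mem (dual_valP chi).
  have := chic 0 => /cvgrPdist_lt/(_ 1 ltr01).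
  apply: filterS => f /=; rewrite -[X in X - _]/(chi 0) dual0 sub0r normrN//.
move=> /Cp_nbhs_fset[A [e [e0 Ae]]].
(* Every multiple of such an [f] lies in the neighborhood, in particular the one on which [chi]
   would be 1. *)
have chiA (f : Cp X K) : (forall x, x \in A -> f x = 0) -> chi f = 0.
  move=> fA; apply/eqP/negPn/negP => chif0.
  have : `|chi ((chi f)^-1 *: f)| < 1.
    by apply: Ae => x /fA fx; rewrite CpZ Cp0 fx mulr0 subrr normr0.
  by rewrite dualZ mulVf// normr1 ltxx.
have /choice[d dA] : forall x, exists d : Cp X K,
    forall y, y \in A -> d y = (y == x)%:R.
  move=> x; have [|f [_ fA]] := Cp_interpolation sepX A (u := fun y => (y == x)%:R).
    by move=> y; case: eqVneq; rewrite ?normr0 ?normr1.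
  by exists f.
exists [fsfun x in A => chi (d x)] => f.
rewrite /fsm_int (fsm_sumE _ _ (G := fun x a => a * f x)) => [|x]; last exact: mul0r.
have chi_sum (s : seq X) :
    chi (\sum_(x <- s) f x *: d x) = \sum_(x <- s) chi (d x) * f x.
  elim: s => [|x s IHs]; first by rewrite !big_nil dual0.
  by rewrite !big_cons dualD dualZ IHs mulrC.
(* It remains to see that [f] minus its interpolant vanishes on [A]. *)
rewrite -chi_sum; apply/eqP; rewrite -subr_eq0 -mulN1r -dualZ -dualD; apply/eqP/chiA.
move=> x xA; rewrite CpD CpZ mulN1r Cp_sum; apply/eqP; rewrite subr_eq0; apply/eqP.
under eq_bigr do rewrite CpZ dA//.
rewrite (big_fsetD1 x)//= eqxx mulr1 big1_seq ?addr0// => y /andP[_].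
by rewrite !inE => /andP[/negPf]; rewrite eq_sym => ->; rewrite mulr0.
Qed.

(** * Barrel-boundedness of the uniform unit ball *)

Section unit_ball.
Context (X : topologicalType) (K : numFieldType).
Context (archiK : archimedean_scalars K) (completeK : cauchy_complete K).

Let D (g : Cp X K) (r : K) := [set h : Cp X K | forall x, `|h x - g x| <= r].

(** Halving radii make the centers uniformly Cauchy; the pointwise limit stays within [r n] of
    [g n], so it is a uniform limit of continuous functions and lies in every ball. *)
Lemma nested_uniform_balls (g : nat -> Cp X K) (r : nat -> K) :
    (forall n, 0 < r n) -> (forall n, r n.+1 <= r n / 2) ->
    (forall n, D (g n.+1) (r n.+1) `<=` D (g n) (r n)) ->
  exists l, forall n, D (g n) (r n) l.
Proof.
move=> r0 r2 Dsub.
have Dle m n : (n <= m)%N -> D (g m) (r m) `<=` D (g n) (r n).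
  elim: m => [|m IHm]; first by rewrite leqn0 => /eqP->.
  rewrite leq_eqVlt => /predU1P[->//|]; rewrite ltnS => /IHm.
  exact: subset_trans.
have gD m n : (n <= m)%N -> D (g n) (r n) (g m).
  by move/Dle; apply => x; rewrite subrr normr0 ltW.
have rle n : r n * 2 ^+ n <= r 0%N.
  elim: n => [|n]; first by rewrite mulr1.
  apply: le_trans; rewrite exprS mulrA ler_pM2r ?exprn_gt0//.
  by rewrite -ler_pdivlMr.
have r_small e : 0 < e -> exists n, r n < e.
  (* An [n] above [r 0 / e] suffices because [n < 2 ^ n]. *)
  move=> e0; have [n ne] := archiK (divr_gt0 (r0 0%N) e0).
  exists n; rewrite ltr_pdivrMr// in ne.
  rewrite -(ltr_pM2r (exprn_gt0 n (ltr0n K 2))) (le_lt_trans (rle n))//.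
  rewrite (lt_le_trans ne)// mulrC ler_pM2l// -natrX ler_nat.
  exact/ltnW/ltn_expl.
have lim x : exists l, forall e : K, 0 < e ->
    exists N, forall n, (N <= n)%N -> `|l - g n x| < e.
  apply: completeK => e e0; have [N rN] := r_small _ (divr_gt0 e0 (ltr0n K 2)).
  exists N => m n Nm Nn; rewrite -(subrK (g N x) (g m x)) -addrA [ltRHS]splitr.
  apply: le_lt_trans (ler_normD _ _) _; rewrite (distrC (g N x)).
  by apply: ltrD; apply: le_lt_trans rN; apply: gD.
have /choice[l gl] := lim.
have lD n x : `|l x - g n x| <= r n.
  apply/ler_addgt0Pr => e e0; have [N /(_ (maxn n N) (leq_maxr _ _)) lN] := gl x e e0.
  rewrite -(subrK (g (maxn n N) x) (l x)) -addrA.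
  rewrite (le_trans (ler_normD _ _))// [leRHS]addrC lerD//; first exact: ltW.
  exact: (gD _ _ (leq_maxl _ _)).
have lc : l \in @continuous_function X K.
  rewrite inE => x; apply/cvgrPdist_lt => e e0.
  have e30 : 0 < e / 3 by rewrite divr_gt0.
  have [N rN] := r_small _ e30.
  have gc : continuous (g N) := set_mem (Cp_valP (g N)).
  have := gc x => /cvgrPdist_lt/(_ _ e30); apply: filterS => y gxy.
  have -> : l x - l y = (l x - g N x) + (g N x - g N y) - (l y - g N y).
    by ring.
  have -> : e = e / 3 + e / 3 + e / 3 by field.
  rewrite (le_lt_trans (ler_normB _ _))// ltrD ?(le_lt_trans (lD _ _))//.
  by rewrite (le_lt_trans (ler_normD _ _))// ltrD ?(le_lt_trans (lD _ _)).
by exists (MkCp lc).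
Qed.

(** Baire's argument: if no ball were contained in any multiple [V n] of [U], one could choose
    nested balls, step [n] avoiding [V n]; their common point would lie in no [V n], against
    absorbency. *)
Lemma barrel_uniform_ball (U : set (Cp X K)) : barrel U ->
  exists (n : nat) g r, 0 < r /\ D g r `<=` [set f | U (n.+1%:R^-1 *: f)].
Proof.
move=> bU; have [_ abU _] := bU.
pose V n := [set f : Cp X K | U (n.+1%:R^-1 *: f)].
have clV n : closed (V n).
  have n0 : n.+1%:R^-1 != 0 :> K by rewrite invr_eq0 pnatr_eq0.
  by have [] := barrel_scale n0 bU.
apply: contrapT => nV.
(* One step of the construction, guarded by [0 < p.2.2] so that choice applies to all [p]; the value
   [(0, 0)] is a dummy. *)
have : forall p : nat * (Cp X K * K), exists q : Cp X K * K, 0 < p.2.2 ->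
    [/\ 0 < q.2, q.2 <= p.2.2 / 2, D q.1 q.2 `<=` D p.2.1 p.2.2 &
        D q.1 q.2 `<=` ~` V p.1].
  move=> [n [g r]] /=; have [r0|] := boolP (0 < r); last by exists (0, 0).
  have r20 : 0 < r / 2 by rewrite divr_gt0.
  have /existsNP[h /not_implyP[hg nVh]] : ~ (D g (r / 2) `<=` V n).
    by move=> gV; apply: nV; exists n, g, (r / 2).
  have : nbhs h (~` V n) by apply: open_nbhs_nbhs; split=> //; rewrite openC.
  move=> /Cp_nbhs_fset[A [e [e0 AeV]]].
  (* The bound [s < e] puts the ball around [h] inside the pointwise neighborhood missing [V n], and
     [s <= r / 2] keeps it inside [D g r]. *)
  have [s [s0 se sr]] : exists s, [/\ 0 < s, s < e & s <= r / 2].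
    have e2 : e / 2 < e by rewrite ltr_pdivrMr// ltr_pMr// ltr1n.
    have e20 : 0 < e / 2 by rewrite divr_gt0.
    have [er|re] := real_leP (gtr0_real e20) (gtr0_real r20).
      by exists (e / 2).
    by exists (r / 2); split=> //; exact: lt_trans e2.
  exists (h, s) => _ /=; split=> // f hf; last first.
    by apply: AeV => x _; rewrite distrC (le_lt_trans _ se).
  move=> x; rewrite -(subrK (h x) (f x)) -addrA [leRHS]splitr.
  rewrite (le_trans (ler_normD _ _))// lerD//.
  exact: le_trans (hf x) sr.
move=> /choice[F FP].
pose z := fix z n := if n is m.+1 then F (m, z m) else (0, 1).
have z0 n : 0 < (z n).2 by elim: n => [|n /(FP (n, z n))[]] //=.
have [||l lz] := nested_uniform_balls (g := fst \o z) (r := snd \o z) z0.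
- by move=> n; have [] := FP (n, z n) (z0 n).
- by move=> n; have [] := FP (n, z n) (z0 n).
(* Absorbency puts [l] in [V n] as soon as [n.+1] exceeds [r], while the ball [z n.+1] was chosen to
   miss [V n]. *)
have [r r0 rU] := abU l; have [n rn] := archiK r0.
have [_ _ _ zV] := FP (n, z n) (z0 n).
apply: (zV l (lz n.+1)); rewrite /V /=.
have [|u Uu <-] := rU n.+1%:R.
  by rewrite normr_nat (le_trans (ltW rn))// ler_nat.
by rewrite scalerA mulVf ?pnatr_eq0// scale1r.
Qed.

(** Up to scaling, a barrel contains a uniform ball around some [g]; absolute convexity moves the
    center to 0, as [r f] is half the difference of [g + r f] and [g - r f]. *)
Lemma Cp_unit_ball_barrel_bounded :
  barrel_bounded [set f : Cp X K | forall x, `|f x| <= 1].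
Proof.
move=> U bU; have [n [g [r [r0 gU]]]] := barrel_uniform_ball bU.
have [_ _ cvU] := bU.
have [m rm] := archiK (divr_gt0 (ltr0Sn K n) r0).
have m0 : 0 < m%:R :> K by apply: lt_trans rm; rewrite divr_gt0.
exists m => f /= f1.
have half_sum : `|2^-1| + `|- 2^-1| <= 1 :> K.
  by rewrite normrN ger0_norm ?invr_ge0// [leRHS]splitr mul1r.
have Urf : U (n.+1%:R^-1 *: (r *: f)).
  have -> : n.+1%:R^-1 *: (r *: f) =
      2^-1 *: (n.+1%:R^-1 *: (g + r *: f)) +
      (- 2^-1) *: (n.+1%:R^-1 *: (g - r *: f)).
    by apply: Cp_ext => x; rewrite !(CpZ, CpD, CpN); field; rewrite nat1r pnatr_eq0.
  apply: cvU => //; apply: gU => x; rewrite !(CpZ, CpD, CpN).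
    by rewrite addrC addKr normrM gtr0_norm// ler_piMr// ltW.
  by rewrite addrAC subrr sub0r normrN normrM gtr0_norm// ler_piMr// ltW.
exists (m%:R^-1 *: f); last by rewrite scalerA mulfV ?gt_eqF// scale1r.
(* Absolute convexity is stated for two terms, so a single vector is scaled by adding a term with
   coefficient 0. *)
have -> : m%:R^-1 *: f = (n.+1%:R / r / m%:R) *: (n.+1%:R^-1 *: (r *: f)) +
    0 *: (n.+1%:R^-1 *: (r *: f)).
  rewrite scale0r addr0 !scalerA; congr (_ *: _); field.
  by rewrite !gt_eqF.
apply: cvU => //; rewrite normr0 addr0 gtr0_norm ?divr_gt0//.
by rewrite ler_pdivrMr// mul1r ltW.
Qed.

End unit_ball.

(** * The quadratic barrel *)

Lemma sqr_convex (K : numFieldType) (s t p q : K) : 0 <= s -> 0 <= t -> 0 <= p -> 0 <= q ->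
  s + t <= 1 -> (s * p + t * q) ^+ 2 <= s * p ^+ 2 + t * q ^+ 2.
Proof.
move=> s0 t0 p0 q0 st1; rewrite -subr_ge0.
(* The weights add up to at most 1, whence the second term on the right. *)
have -> : s * p ^+ 2 + t * q ^+ 2 - (s * p + t * q) ^+ 2 =
    s * t * (p - q) ^+ 2 + (1 - (s + t)) * (s * p ^+ 2 + t * q ^+ 2) by ring.
have pq0 : 0 <= (p - q) ^+ 2 by rewrite real_exprn_even_ge0// realB ?ger0_real.
apply: addr_ge0; first by apply: mulr_ge0 => //; exact: mulr_ge0.
by apply: mulr_ge0; rewrite ?subr_ge0// addr_ge0// mulr_ge0// exprn_ge0.
Qed.

Lemma closed_unit_disc (K : numFieldType) : closed [set z : K | `|z| <= 1].
Proof.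
move=> z clz; apply/ler_addgt0Pr => e e0.
have [y [/= y1 zy]] := clz _ (nbhsx_ballx z e e0).
rewrite -(subrK y z) addrC (le_trans (ler_normD _ _))// lerD//.
by move: zy; rewrite -ball_normE => /ltW.
Qed.

Section quadratic_barrel.
Context (X : topologicalType) (K : numFieldType) (nu : nat -> fsmeasure X K).

(** The integral of the square of [|f|] against the variation of [nu n]. *)
Let S n (f : Cp X K) := \sum_(x <- finsupp (nu n)) `|nu n x| * `|f x| ^+ 2.

Let S_ge0 n f : 0 <= S n f.
Proof. by apply: sumr_ge0 => x _; rewrite mulr_ge0 ?exprn_ge0. Qed.

Lemma quadratic_barrel : (forall f, exists M, forall n, S n f <= M) ->
  barrel [set f | forall n, S n f <= 1].
Proof.
move=> Sbnd; split.
- have -> : [set f | forall n, S n f <= 1] =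
      \bigcap_n [set f | [set z : K | `|z| <= 1] (S n f)].
    by apply/seteqP; split=> f Sf n; have := Sf n; rewrite /= ger0_norm//; exact.
  apply: closed_bigI => n _; apply: preimage_closed; last exact: closed_unit_disc.
  move=> f _; rewrite /S; elim: (enum_fset (finsupp (nu n))) => [|x s IHs].
    by under eq_fun do rewrite big_nil; exact: cst_continuous.
  under eq_fun do rewrite big_cons.
  apply: cvgD IHs; apply: cvgM; first exact: cvg_cst.
  have evc : `|g x| @[g --> f] --> `|f x|.
    by apply: cvg_norm; exact: Cp_eval_continuous.
  by under eq_fun do rewrite expr2; rewrite expr2; exact: cvgM.
- move=> f; have [M SM] := Sbnd f; have M0 := le_trans (S_ge0 0 f) (SM 0%N).
  (* With [M + 1] both [1 <= |a|] and [M <= |a|] hold, so [M <= |a| ^ 2], which absorbs the square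
     coming out of [S]. *)
  exists (M + 1) => [|a Ma]; first by rewrite ltr_wpDl.
  have a1 : 1 <= `|a| by rewrite (le_trans _ Ma)// lerDr.
  have a0 : a != 0 by rewrite -normr_gt0 (lt_le_trans ltr01).
  exists (a^-1 *: f); last by rewrite scalerA mulfV// scale1r.
  move=> n; have -> : S n (a^-1 *: f) = S n f / `|a| ^+ 2.
    rewrite /S mulr_suml; apply: eq_bigr => x _.
    by rewrite CpZ normrM normfV exprMn exprVn; ring.
  rewrite ler_pdivrMr ?exprn_gt0 ?normr_gt0// mul1r (le_trans (SM n))//.
  rewrite (le_trans _ (_ : `|a| <= _))//; last by rewrite ler_eXnr.
  by rewrite (le_trans _ Ma)// lerDl.
- move=> f g a b Uf Ug ab n.
  apply: (@le_trans _ _ (`|a| * S n f + `|b| * S n g)).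
    rewrite !mulr_sumr -big_split/=; apply: ler_sum => x _.
    rewrite CpD !CpZ !(mulrCA _ `|nu n x|) -mulrDr ler_wpM2l//.
    apply: le_trans (sqr_convex _ _ _ _ ab) => //.
    by rewrite ler_sqr ?nnegrE ?addr_ge0 ?mulr_ge0// (le_trans (ler_normD _ _))// !normrM.
  by rewrite (le_trans _ ab)// lerD// ler_piMr.
Qed.

End quadratic_barrel.

(** * From JNP to a sequence of unit norm, by contraposition *)

Lemma fsm_norm_vanishes (X : topologicalType) (K : numFieldType) :
  (forall mu : nat -> fsmeasure X K,
    (forall f, fsm_int (mu n) f @[n --> \oo] --> 0) ->
    ~ forall n, fsm_norm (mu n) = 1) ->
  forall nu : nat -> fsmeasure X K,
    (forall f, fsm_int (nu n) f @[n --> \oo] --> 0) ->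
  forall e : K, 0 < e -> \forall n \near \oo, fsm_norm (nu n) < e.
Proof.
move=> no_unit nu nu0 e e0; apply: contrapT => nue.
(* The indices need not increase: [N <= s N] is enough to keep the sequence weak* null. *)
have /choice[s sP] : forall N, exists n, (N <= n)%N /\ e <= fsm_norm (nu n).
  move=> N; apply: contrapT => Ns; apply: nue; exists N => // n /= Nn.
  rewrite (real_ltNge (ger0_real (fsm_norm_ge0 _)) (gtr0_real e0)); apply/negP => en.
  by apply: Ns; exists n.
have s0 N : 0 < fsm_norm (nu (s N)) by have [_] := sP N; exact: lt_le_trans.
apply: (no_unit (fun N =>
    fsm_density (nu (s N)) (fun=> (fsm_norm (nu (s N)))^-1))).
  move=> f; apply/cvgrPdist_lt => d d0.
  (* The factor [e] compensates for the division by norms that are at least [e]. *)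
  have /cvgrPdist_lt/(_ _ (mulr_gt0 d0 e0))[M _ nuM] := nu0 f.
  exists M => // N /= MN; have [Ns es] := sP N.
  rewrite fsm_int_density.
  under eq_bigr do rewrite mulrCA.
  rewrite -mulr_sumr sub0r normrN normrM normfV (gtr0_norm (s0 N)) mulrC ltr_pdivrMr//.
  have := nuM _ (leq_trans MN Ns); rewrite sub0r normrN => /lt_le_trans; apply.
  by rewrite ler_pM2l.
move=> N; rewrite fsm_norm_density -mulr_suml normfV (gtr0_norm (s0 N)).
by rewrite mulfV ?gt_eqF ?s0.
Qed.

Lemma Cp_mul_continuous (X : topologicalType) (K : numFieldType)
    (f g : Cp X K) :
  (fun x => f x * g x) \in @continuous_function X K.
Proof.
have fc : continuous f := set_mem (Cp_valP f).
have gc : continuous g := set_mem (Cp_valP g).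
by rewrite inE => x; apply: cvgM; [exact: fc|exact: gc].
Qed.

Lemma no_unit_sequence_not_JNP (X : topologicalType) (K : numFieldType)
    (sepX : separates_finite_sets X K) :
  (forall mu : nat -> fsmeasure X K,
    (forall f, fsm_int (mu n) f @[n --> \oo] --> 0) ->
    ~ forall n, fsm_norm (mu n) = 1) ->
  ~ JNP (Cp X K).
Proof.
move=> no_unit; apply => u l /weak_star_cvgP ul; apply/beta_star_cvgP => B bB e e0.
(* The differences [u n - l], represented by measures, reduce the claim to a weak* null sequence. *)
have /choice[nu nuE] : forall n, exists nu : fsmeasure X K,
    forall f, (u n : dual _) f - (l : dual _) f = fsm_int nu f.
  move=> n; have [nu nuE] := dual_Cp_fsmeasure sepX ((u n : dual _) - (l : dual _)).
  by exists nu => f; rewrite -nuE.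
have nu0 f : fsm_int (nu n) f @[n --> \oo] --> 0.
  under eq_fun do rewrite -nuE.
  rewrite -(subrr ((l : dual _) f)); apply: cvgB; [exact: ul|exact: cvg_cst].
have norm0 := fsm_norm_vanishes no_unit nu0.
(* The sum is the norm of the measure with density [f ^ 2]; these measures are weak* null because
   testing on [g] amounts to testing [nu n] on [f * (f * g)]. *)
have sqr0 (f : Cp X K) : forall d : K, 0 < d ->
    \forall n \near \oo, \sum_(x <- finsupp (nu n)) `|nu n x| * `|f x| ^+ 2 < d.
  move=> d d0.
  have := fsm_norm_vanishes no_unit
    (nu := fun n => fsm_density (nu n) (fun x => f x ^+ 2)).
  move=> /(_ _ d d0) H; apply: filterS (H _) => [n|g].
    by rewrite fsm_norm_density; under eq_bigr do rewrite normrX.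
  rewrite (_ : (fun _ => _) = fun n =>
    fsm_int (nu n) (MkCp (Cp_mul_continuous f (MkCp (Cp_mul_continuous f g)))));
    first exact: nu0.
  apply/funext => i; rewrite fsm_int_density.
  by apply: eq_bigr => x _; rewrite expr2 -mulrA.
have [|m Bm] := bB _ (quadratic_barrel (nu := nu) _).
  move=> f; have [N _ fN] := sqr0 f 1 ltr01.
  (* The finite total bounds each of the first [N] sums, and 1 bounds every later one. *)
  exists (1 + \sum_(i < N) \sum_(x <- finsupp (nu i)) `|nu i x| * `|f x| ^+ 2) => n.
  have s0 i : 0 <= \sum_(x <- finsupp (nu i)) `|nu i x| * `|f x| ^+ 2.
    by apply: sumr_ge0 => x _; rewrite mulr_ge0 ?exprn_ge0.
  have [nN|Nn] := ltnP n N; last by rewrite ler_wpDr ?sumr_ge0 ?ltW ?fN.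
  by rewrite (bigD1 (Ordinal nN))//= ler_wpDl// lerDl sumr_ge0.
(* The final bound is [m (d + d ^ 2 / d) = 2 m d = e m / (m + 1)]; the denominator [m + 1] makes it
   strictly less than [e] and allows [m = 0]. *)
pose d := e / m.+1%:R / 2.
have d0 : 0 < d by rewrite !divr_gt0.
have := norm0 (d ^+ 2) (exprn_gt0 2 d0); apply: filterS => n nun f /Bm[g Ug <-].
rewrite distrC nuE /fsm_int (le_lt_trans (ler_norm_sum _ _ _))//.
have gle x : `|g x| <= d * `|g x| ^+ 2 + d^-1.
  rewrite -subr_ge0.
  have -> : d * `|g x| ^+ 2 + d^-1 - `|g x| =
      ((d * `|g x| - 1) ^+ 2 + d * `|g x|) / d.
    by field; rewrite gt_eqF.
  have dg0 : 0 <= d * `|g x| by rewrite mulr_ge0// ltW.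
  apply: divr_ge0 (ltW d0); apply: addr_ge0 (dg0).
  by rewrite real_exprn_even_ge0//; exact: realB (ger0_real dg0) (real1 _).
apply: (@le_lt_trans _ _ (\sum_(x <- finsupp (nu n))
    m%:R * (d * (`|nu n x| * `|g x| ^+ 2) + d^-1 * `|nu n x|))).
  apply: ler_sum => x _; rewrite CpZ !normrM normr_nat mulrCA ler_wpM2l//.
  by rewrite mulrCA [d^-1 * _]mulrC -mulrDr ler_wpM2l.
rewrite -mulr_sumr big_split/= -!mulr_sumr.
apply: (@le_lt_trans _ _ (m%:R * (d * 1 + d^-1 * d ^+ 2))).
  by rewrite ler_wpM2l// lerD// ler_wpM2l ?invr_ge0 ?(ltW d0) ?(ltW nun)//; exact: Ug.
have -> : m%:R * (d * 1 + d^-1 * d ^+ 2) = m%:R / m.+1%:R * e.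
  by rewrite /d; field; rewrite (gt_eqF e0) nat1r pnatr_eq0.
by rewrite gtr_pMl// ltr_pdivrMr// mul1r ltr_nat.
Qed.

(** * From a sequence of unit norm to JNP *)

Lemma unit_sequence_JNP (X : topologicalType) (K : numFieldType)
    (sepX : separates_finite_sets X K)
    (mu : nat -> fsmeasure X K) :
  barrel_bounded [set f : Cp X K | forall x, `|f x| <= 1] ->
  (forall f, fsm_int (mu n) f @[n --> \oo] --> 0) ->
  (forall n, fsm_norm (mu n) = 1) ->
  JNP (Cp X K).
Proof.
move=> bB mu0 mu1 sc.
(* Sequential continuity would make [mu n] tend to 0 uniformly on the unit ball. *)
have /sc/beta_star_cvgP/(_ _ bB 1 ltr01)[N _ muN] :
    ((fun n => fsm_dual (mu n)) : nat -> weak_star (Cp X K)) @ \oo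
      --> (0 : weak_star _).
  by apply/weak_star_cvgP.
(* These are the conjugate phases of the masses, so that pairing with [mu N] sums the moduli. Off
   the support the quotient is 0. *)
have [|f [f1 fE]] := Cp_interpolation sepX (finsupp (mu N))
    (u := fun x => `|mu N x| / mu N x).
  move=> x; rewrite normrM normfV normr_id.
  by have [->|x0] := eqVneq (mu N x) 0; rewrite ?normr0 ?mul0r// divff ?normr_eq0.
have := muN N (leqnn N) f f1.
rewrite /= sub0r normrN.
have -> : fsm_int (mu N) f = 1.
  rewrite -(mu1 N); apply: eq_big_seq => x xN.
  by rewrite fE// mulrC divfK// -mem_finsupp.
by rewrite normr1 ltxx.
Qed.

Theorem corollary3p10 (R : realType) (k : scalars) (X : topologicalType)
    (tychonoffX : tychonoff_space X) (infiniteX : infinite_set [set: X]) :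
  JNP (Cp X (scalar_field R k)) <->
  exists mu : nat -> fsmeasure X (scalar_field R k),
    (fun n => fsm_dual (mu n) : weak_star (Cp X (scalar_field R k))) @ \oo
      --> (0 : weak_star (Cp X (scalar_field R k))) /\
    forall n, fsm_norm (mu n) = 1.
Proof.
have sepX := @tychonoff_separates_finite_sets R k X tychonoffX.
split=> [jnp|[mu [/weak_star_cvgP mu0 mu1]]].
  apply: contrapT => no_unit; apply: (no_unit_sequence_not_JNP sepX) jnp.
  move=> mu mu0 mu1; apply: no_unit; exists mu; split=> //.
  exact/weak_star_cvgP.
apply: (unit_sequence_JNP sepX _ mu0 mu1).
apply: Cp_unit_ball_barrel_bounded; first exact: scalar_archimedean.
exact: scalar_cauchy_complete.
Qed.
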